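(* Consider an M/G/1 queue with Poisson arrivals of rate $\lambda>0$ and i.i.d. service times distributed as $S$, where $S$ has a density with Laplace transform $\varphi$. Let $W+1$ be the number of customers served in a busy period (started by a single customer arriving to an empty system). Let $p=\mathbb{E}e^{-\lambda S}$, let $\xi$ be the real solution of $1+\lambda\varphi'(s)=0$ nearest the origin, and let $$\theta=\frac{\xi-\lambda+\lambda\varphi(\xi)}{(\xi-\lambda)\varphi(\lambda)}.$$ Suppose that $S$ is IFR and that $\rho=\lambda\mathbb{E}S<1$. Let $N\sim\mathrm{Geom}(p)$ and $Y=\sum_{i=1}^N X_i$, where $X,X_1,X_2,\ldots$ are i.i.d. positive, integer-valued random variables independent of $N$ with $(1-p)\theta\,\mathbb{E}X\geq1-p\theta$. Then $$d_{TV}(\mathcal{L}(W),\mathcal{L}(Y))\leq H_p(X)\left(\frac{(1-p)\mathbb{E}X}{p}-\frac{\rho}{1-\rho}\right).$$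
   Context: A continuous nonnegative random variable $S$ with density $f$ is IFR if its failure rate $f(t)/\mathbb{P}(S>t)$ is nondecreasing in $t$. $N\sim\mathrm{Geom}(p)$ means $\mathbb{P}(N=k)=p(1-p)^k$, $k\ge0$; the empty sum is $0$. $d_{TV}(\mathcal{L}(U),\mathcal{L}(V))=\sup_{A\subseteq\{0,1,2,\ldots\}}|\mathbb{P}(U\in A)-\mathbb{P}(V\in A)|$. For $0\le p\le1$ and positive integer-valued $X$, with $u=1-d_{TV}(\mathcal{L}(X),\mathcal{L}(X+1))$, $H_p(X)=\min\{p+(1-p)\mathbb{P}(X>1),\ p(1+\sqrt{-2/(u\log(1-p))})\}$. *)

(* Defs.v *)
From HB Require Import structures.
From mathcomp Require Import all_boot all_order all_algebra.
From mathcomp Require Import all_classical all_reals all_analysis.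
Set Implicit Arguments. Unset Strict Implicit. Unset Printing Implicit Defensive.
Import Order.TTheory GRing.Theory Num.Theory.
Import numFieldNormedType.Exports.
Local Open Scope classical_set_scope.
Local Open Scope ring_scope.

Section Defs.
Variable R : realType.
Local Notation mu := (@lebesgue_measure R).

(* ---------- the service time S, given by a density f on R (f = 0 on ]-oo,0[) ---------- *)

Definition surv (f : R -> R) (t : R) : R :=
  fine (\int[mu]_(x in `]t, +oo[) (f x)%:E)%E.

(* S is IFR: the failure rate f(t)/P(S>t) is nondecreasing in t
   (where it is defined, i.e. where P(S>t) > 0). *)
Definition IFR (f : R -> R) : Prop :=
  forall s t : R, s <= t -> 0 < surv f t -> f s / surv f s <= f t / surv f t.

Definition ES (f : R -> R) : \bar R := (\int[mu]_(x in setT) (x * f x)%:E)%E.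

(* Laplace transform phi(s) = E e^{-sS} (extended real; may be +oo for s < 0) *)
Definition laplaceE (f : R -> R) (s : R) : \bar R :=
  (\int[mu]_(x in setT) (expR (- (s * x)) * f x)%:E)%E.

Definition laplace (f : R -> R) (s : R) : R := fine (laplaceE f s).

Definition laplace_root (f : R -> R) (lam s : R) : Prop :=
  (exists2 e : R, 0 < e & forall r : R, `|r - s| < e -> (laplaceE f r < +oo)%E)
  /\ derivable (laplace f) s 1
  /\ 1 + lam * derive1 (laplace f) s = 0.

Definition nearest_laplace_root (f : R -> R) (lam xi : R) : Prop :=
  laplace_root f lam xi /\ (forall s : R, laplace_root f lam s -> `|xi| <= `|s|).

(* law of the number of Poisson(lam) arrivals during one service:
   a_k = E[ e^{-lam S} (lam S)^k / k! ] *)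
Definition arrivals_pmf (f : R -> R) (lam : R) (k : nat) : R :=
  fine (\int[mu]_(x in setT)
          (f x * expR (- (lam * x)) * (lam * x) ^+ k / (k`!)%:R)%:E)%E.

(* P(number served in the busy period = n), n >= 1.  With A_1, A_2, ... i.i.d.
   arrivals during successive services, the number left after the j-th departure
   is 1 + sum_{i<=j} (A_i - 1) and the busy period ends at the first j where it is
   0.  Every A_i with i <= n is then <= n-1, so sequences range over 'I_n. *)
Definition served_pmf (a : nat -> R) (n : nat) : R :=
  \sum_(s : {ffun 'I_n -> 'I_n} |
          ((\sum_(i < n) (s i : nat))%N == n.-1)
          && [forall j : 'I_n, (j <= \sum_(i < n | (i < j)%N) (s i : nat))%N])
     \prod_(i < n) a (s i).

Definition W_pmf (f : R -> R) (lam : R) (m : nat) : R :=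
  served_pmf (arrivals_pmf f lam) m.+1.

Definition prob_in (u : nat -> R) (A : set nat) : R :=
  fine (\sum_(k <oo | k \in A) (u k)%:E)%E.

Definition dTV (u v : nat -> R) : R :=
  sup [set r : R | exists A : set nat, r = `|prob_in u A - prob_in v A|].

Definition mean (u : nat -> R) : \bar R := (\sum_(k <oo) (k%:R * u k)%:E)%E.

Definition shift_pmf (u : nat -> R) (n : nat) : R :=
  if n is m.+1 then u m else 0.

Definition conv (u v : nat -> R) (n : nat) : R :=
  \sum_(i < n.+1) u i * v (n - i)%N.

Fixpoint convpow (u : nat -> R) (k : nat) : nat -> R :=
  match k with
  | 0 => fun n => if n == 0%N then 1 else 0
  | k'.+1 => conv (convpow u k') u
  end.

Definition compound_geom_pmf (p : R) (u : nat -> R) (n : nat) : R :=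
  fine (\sum_(k <oo) (p * (1 - p) ^+ k * convpow u k n)%:E)%E.

(* H_p(X).  When u = 0 the second term of the min is +oo (division by 0 in the
   paper), so H_p(X) is then the first term. *)
Definition Hp (p : R) (q : nat -> R) : R :=
  let u := 1 - dTV q (shift_pmf q) in
  let t1 := p + (1 - p) * prob_in q [set k | (1 < k)%N] in
  if u == 0 then t1
  else Num.min t1 (p * (1 + Num.sqrt (- 2 / (u * ln (1 - p))))).

End Defs.

(* Main.v *)
Require Import Defs.
From HB Require Import structures.
From mathcomp Require Import all_boot all_order all_algebra.
From mathcomp Require Import all_classical all_reals all_analysis.
From mathcomp Require Import measurable_realfun ring lra.
Set Implicit Arguments.
Unset Strict Implicit.
Unset Printing Implicit Defensive.
Import Order.TTheory GRing.Theory Num.Theory.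
Import numFieldNormedType.Exports.
Local Open Scope classical_set_scope.
Local Open Scope ring_scope.

(* [W] and [Y] both put mass [p] at 0, so their total variation distance is at most
   [1 - p]; as [H_p(X) >= p], it suffices that
   [(1 - p) EX / p - rho / (1 - rho) >= (1 - p) / p]. The heart of the matter is
   [0 <= p theta <= (1 - rho) ^ 2]. Since [phi] is convex, its tangent at [xi], of slope
   [- 1 / lam], passes below [phi(0) = 1]; hence [xi + lam phi(xi) <= lam] and
   [p theta >= 0]. Jensen's inequality [phi(s) >= exp(- s ES)] at [s = xi] gives the
   upper bound. The hypothesis on [EX] then yields
   [(1 - p) EX / p >= (1 - p theta) / (p theta) >= 2 rho / (1 - rho)], while Jensen's
   inequality at [s = lam] gives [p >= 1 - rho], that is
   [(1 - p) / p <= rho / (1 - rho)]. *)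

Section Subprobability.
Context {R : realType}.
Implicit Types (u v : nat -> R) (A : set nat).

Definition subpmf u := (forall k, 0 <= u k) /\ (\sum_(k <oo) (u k)%:E <= 1)%E.

Lemma subpmfP u :
  subpmf u <-> (forall k, 0 <= u k) /\ (forall N, \sum_(k < N) u k <= 1).
Proof.
split=> -[u_ge0 u_le1]; split=> //.
  move=> N; rewrite -lee_fin -sumEFin -(big_mkord xpredT (fun k => (u k)%:E)).
  by apply: le_trans u_le1; apply: nneseries_lim_ge => k _ _; rewrite lee_fin.
apply: lime_le; first by apply: is_cvg_nneseries => k _ _; rewrite lee_fin.
by apply: nearW => N; rewrite sumEFin lee_fin big_mkord.
Qed.

Lemma subpmf_fine (c : nat -> \bar R) :
  (forall k, 0 <= c k)%E -> (\sum_(k <oo) c k <= 1)%E -> subpmf (fine \o c).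
Proof.
move=> c_ge0 c_le1; split=> [k|]; first exact: fine_ge0.
rewrite (eq_eseriesr (g := c))// => k _; rewrite /= fineK// ge0_fin_numE//.
apply: le_lt_trans (ltry 1); apply: le_trans c_le1.
by rewrite (@nneseriesD1 _ _ k)// leeDl// nneseries_ge0.
Qed.

Lemma prob_in_ge0 u A : (forall k, 0 <= u k) -> 0 <= prob_in u A.
Proof. by move=> u_ge0; apply/fine_ge0/nneseries_ge0 => k _ _; rewrite lee_fin. Qed.

Lemma prob_inE u A :
  subpmf u -> (prob_in u A)%:E = (\sum_(k <oo | k \in A) (u k)%:E)%E.
Proof.
move=> [u_ge0 u_le1]; rewrite fineK// ge0_fin_numE; last first.
  by apply: nneseries_ge0 => k _ _; rewrite lee_fin.
apply: le_lt_trans (ltry 1); apply: le_trans u_le1.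
by apply: subset_lee_nneseries => // k _; rewrite lee_fin.
Qed.

Lemma prob_in_le1 u A : subpmf u -> prob_in u A <= 1.
Proof.
move=> u_sub; rewrite -lee_fin prob_inE//; apply: le_trans u_sub.2.
by apply: subset_lee_nneseries => // k _; rewrite lee_fin u_sub.1.
Qed.

Lemma prob_inD1 u A n : subpmf u ->
  prob_in u A = (n \in A)%:R * u n + prob_in u (A `\ n).
Proof.
move=> u_sub; have [nA|nA] := boolP (n \in A); last first.
  by rewrite mul0r add0r not_setD1// -notin_setE.
apply: EFin_inj; rewrite mul1r EFinD !prob_inE// (@nneseriesD1 _ _ n)//.
  by congr +%E; apply: eq_eseriesl => k; rewrite in_setD in_set1.
by move=> k _; rewrite lee_fin u_sub.1.
Qed.

Lemma prob_inD1_le u A n : subpmf u -> prob_in u (A `\ n) <= 1 - u n.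
Proof.
move=> u_sub; rewrite lerBrDl.
have := prob_in_le1 (A `|` [set n]) u_sub.
rewrite (prob_inD1 _ n)// mem_set ?mul1r; last by right.
by rewrite setDUl setDv setU0.
Qed.

Lemma dTV_le_common_atom u v n : subpmf u -> subpmf v -> u n = v n ->
  dTV u v <= 1 - u n.
Proof.
move=> u_sub v_sub uv; apply: ge_sup.
  by exists `|prob_in u set0 - prob_in v set0|, set0.
move=> _ [A ->]; rewrite (prob_inD1 A n u_sub) (prob_inD1 A n v_sub) -uv ler_norml.
have := prob_inD1_le A n u_sub; have := prob_inD1_le A n v_sub; rewrite -uv.
have := prob_in_ge0 (A `\ n) u_sub.1; have := prob_in_ge0 (A `\ n) v_sub.1; lra.
Qed.

Lemma subpmf_mixture u (c : nat -> nat -> R) : subpmf u -> (forall k, subpmf (c k)) ->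
  subpmf (fun n => fine (\sum_(k <oo) (u k * c k n)%:E)%E).
Proof.
move=> [u_ge0 u_le1] c_sub.
have uc_ge0 k n : (0 <= (u k * c k n)%:E)%E by rewrite lee_fin mulr_ge0// (c_sub k).1.
apply: subpmf_fine => [n|]; first exact: nneseries_ge0.
rewrite nneseries_interchange//; apply: le_trans u_le1; apply: lee_nneseries => k.
  by move=> _ _; exact: nneseries_ge0.
move=> _; have [ck_ge0 ck_le1] := c_sub k.
under eq_eseriesr do rewrite EFinM.
rewrite nneseriesZl; last by move=> n _; rewrite lee_fin.
by rewrite -[leRHS]mule1 lee_wpmul2l// lee_fin.
Qed.

End Subprobability.

Definition ffun_cons {n} {T : Type} (x : T) (t : {ffun 'I_n -> T}) : {ffun 'I_n.+1 -> T} :=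
  [ffun i => oapp t x (unlift ord0 i)].

Lemma ffun_cons0 n (T : Type) (x : T) (t : {ffun 'I_n -> T}) :
  ffun_cons x t ord0 = x.
Proof. by rewrite ffunE unlift_none. Qed.

Lemma ffun_consS n (T : Type) (x : T) (t : {ffun 'I_n -> T}) i :
  ffun_cons x t (lift ord0 i) = t i.
Proof. by rewrite ffunE liftK. Qed.

Lemma ffun_cons_bij n (T : Type) :
  bijective (fun xt : T * {ffun 'I_n -> T} => ffun_cons xt.1 xt.2).
Proof.
exists (fun s : {ffun 'I_n.+1 -> T} => (s ord0, [ffun j => s (lift ord0 j)])).
  case=> x t; rewrite /= ffun_cons0; congr (_, _).
  by apply/ffunP => j; rewrite ffunE ffun_consS.
move=> s; apply/ffunP => i; case: (unliftP ord0 i) => [j|] ->.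
  by rewrite ffun_consS ffunE.
by rewrite ffun_cons0.
Qed.

Lemma sum_ffun_recl (V : nmodType) n (T : finType) (P : pred {ffun 'I_n.+1 -> T})
    (F : {ffun 'I_n.+1 -> T} -> V) :
  \sum_(s | P s) F s = \sum_x \sum_(t | P (ffun_cons x t)) F (ffun_cons x t).
Proof.
by rewrite (reindex _ (onW_bij _ (ffun_cons_bij n T))) pair_big_dep.
Qed.

Section FirstPassage.
Context {R : realType}.

(* A queue of [c] customers, joined by [s i] others during the [i]-th service,
   becomes empty exactly at the [n]-th departure. *)
Definition empties_at {n K} (c : nat) (s : {ffun 'I_n -> 'I_K}) : bool :=
  (c + (\sum_(i < n) (s i : nat))%N == n)%N &&
  [forall j : 'I_n, (j < c + \sum_(i < n | (i < j)%N) (s i : nat))%N].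

Lemma empties_at_cons n K c (k : 'I_K) (t : {ffun 'I_n -> 'I_K}) :
  empties_at c.+1 (ffun_cons k t) = empties_at (c + k) t.
Proof.
have arrivals_before (j : 'I_n) :
    (\sum_(i < n.+1 | (i < lift ord0 j)%N) (ffun_cons k t i : nat) =
     k + \sum_(i < n | (i < j)%N) (t i : nat))%N.
  rewrite big_mkcond big_ord_recl ffun_cons0 [in RHS]big_mkcond; congr addn.
  by apply: eq_bigr => i _; rewrite ffun_consS !lift0 ltnS.
rewrite /empties_at big_ord_recl ffun_cons0; under eq_bigr do rewrite ffun_consS.
rewrite addSn eqSS addnA; congr (_ && _).
have bound_lift (j : 'I_n) : (lift ord0 j < c.+1 + \sum_(i < n.+1 | (i < lift ord0 j)%N)
    (ffun_cons k t i : nat))%N = (j < c + k + \sum_(i < n | (i < j)%N) (t i : nat))%N.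
  by rewrite arrivals_before lift0 addSn ltnS addnA.
apply/forallP/forallP => bound j; first by rewrite -bound_lift.
by case: (unliftP ord0 j) => [i|] ->; rewrite ?bound_lift.
Qed.

Variable a : nat -> R.

Definition emptying_pmf (K c n : nat) : R :=
  \sum_(s : {ffun 'I_n -> 'I_K} | empties_at c s) \prod_(i < n) a (s i).

Lemma served_pmfE n : served_pmf a n.+1 = emptying_pmf n.+1 1 n.+1.
Proof. by apply: eq_bigl => s; rewrite /empties_at add1n eqSS. Qed.

Lemma emptying_pmf_at0 K c : emptying_pmf K c 0 = (c == 0%N)%:R.
Proof.
have empties_at0 (s : {ffun 'I_0 -> 'I_K}) : empties_at c s = (c == 0%N).
  by rewrite /empties_at big_ord0 addn0; apply/andb_idr => _; apply/forallP => -[].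
rewrite /emptying_pmf (eq_bigl _ _ empties_at0); under eq_bigr do rewrite big_ord0.
case: (c == 0%N); last by rewrite big_pred0.
by rewrite sumr_const card_ffun !card_ord expn0.
Qed.

Lemma emptying_pmf_no_customer K n : emptying_pmf K 0 n.+1 = 0.
Proof.
rewrite /emptying_pmf big_pred0// => s; apply/negP => /andP[_ /forallP/(_ ord0)].
by rewrite big_pred0.
Qed.

Lemma emptying_pmf_first_step K c n :
  emptying_pmf K c.+1 n.+1 = \sum_(k < K) a k * emptying_pmf K (c + k) n.
Proof.
rewrite /emptying_pmf sum_ffun_recl; apply: eq_bigr => k _.
under eq_bigl do rewrite empties_at_cons.
rewrite mulr_sumr; apply: eq_bigr => t _.
by rewrite big_ord_recl ffun_cons0; under eq_bigr do rewrite ffun_consS.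
Qed.

Hypothesis a_sub : subpmf a.

Lemma emptying_pmf_ge0 K c n : 0 <= emptying_pmf K c n.
Proof. by apply: sumr_ge0 => s _; apply: prodr_ge0 => i _; exact: a_sub.1. Qed.

Lemma le_emptying_pmf K L c n : (K <= L)%N -> emptying_pmf K c n <= emptying_pmf L c n.
Proof.
move=> KL; elim: n c => [|n IH] [|c];
  rewrite ?emptying_pmf_at0 ?emptying_pmf_no_customer// !emptying_pmf_first_step.
rewrite (big_ord_widen _ (fun k => a k * emptying_pmf K (c + k) n) KL) big_mkcond.
apply: ler_sum => k _; case: ifP => _; first by rewrite ler_wpM2l// a_sub.1.
by rewrite mulr_ge0 ?a_sub.1// emptying_pmf_ge0.
Qed.

Lemma sum_emptying_pmf_le1 K c N : \sum_(n < N) emptying_pmf K c n <= 1.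
Proof.
elim: N c => [|N IH] c; first by rewrite big_ord0.
rewrite big_ord_recl emptying_pmf_at0; case: c => [|c] /=.
  by rewrite big1 ?addr0// => n _; exact: emptying_pmf_no_customer.
rewrite add0r; under eq_bigr do rewrite emptying_pmf_first_step.
have [_ sum_a_le1] := (subpmfP a).1 a_sub; apply: le_trans (sum_a_le1 K).
rewrite exchange_big; apply: ler_sum => k _.
by rewrite -mulr_sumr ler_piMr ?a_sub.1.
Qed.

Lemma subpmf_served : subpmf (fun m => served_pmf a m.+1).
Proof.
apply/subpmfP; split=> [m|N]; first by rewrite served_pmfE emptying_pmf_ge0.
apply: le_trans (sum_emptying_pmf_le1 N.+1 1 N.+1).
rewrite big_ord_recl emptying_pmf_at0 add0r; apply: ler_sum => m _.
by rewrite served_pmfE le_emptying_pmf// ltnS ltnW.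
Qed.

Lemma served_pmf1 : served_pmf a 1 = a 0%N.
Proof.
by rewrite served_pmfE emptying_pmf_first_step big_ord1 emptying_pmf_at0 mulr1.
Qed.

End FirstPassage.

Section CompoundGeometric.
Context {R : realType}.
Implicit Types (p : R) (u v : nat -> R).

(* [conv u v] lists the coefficients of a product of polynomials, whose value at 1
   is the product of their values. *)
Lemma sum_conv_le u v N : (forall k, 0 <= u k) -> (forall k, 0 <= v k) ->
  \sum_(k < N) Defs.conv u v k <= (\sum_(i < N) u i) * (\sum_(j < N) v j).
Proof.
move=> u_ge0 v_ge0; pose U := \poly_(i < N) u i; pose V := \poly_(j < N) v j.
have UV_ge0 k : 0 <= (U * V)`_k.
  rewrite coefM sumr_ge0// => i _; rewrite !coef_poly.
  by do 2!case: ifP => _; rewrite ?mulr0 ?mul0r// mulr_ge0.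
have coef_UV (k : 'I_N) : Defs.conv u v k = (U * V)`_k.
  rewrite coefM; apply: eq_bigr => i _; rewrite !coef_poly.
  by rewrite !(leq_ltn_trans _ (ltn_ord k)) ?leq_subr// -ltnS.
have poly_at1 (w : nat -> R) : (\poly_(i < N) w i).[1] = \sum_(i < N) w i.
  by rewrite horner_poly; under eq_bigr do rewrite expr1n mulr1.
have size_UV : (size (U * V)%R <= N + N)%N.
  rewrite (leq_trans (size_polyMleq _ _))// (leq_trans (leq_pred _))//.
  by rewrite leq_add ?size_poly.
rewrite -(poly_at1 u) -(poly_at1 v) -hornerM (horner_coef_wide _ size_UV).
under [leRHS]eq_bigr do rewrite expr1n mulr1.
by rewrite (eq_bigr _ (fun k _ => coef_UV k)) big_split_ord lerDl sumr_ge0.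
Qed.

Lemma subpmf_conv u v : subpmf u -> subpmf v -> subpmf (Defs.conv u v).
Proof.
move=> /subpmfP[u_ge0 u_le1] /subpmfP[v_ge0 v_le1]; apply/subpmfP; split=> [k|N].
  by apply: sumr_ge0 => i _; rewrite mulr_ge0.
by apply: le_trans (sum_conv_le N u_ge0 v_ge0) _; rewrite mulr_ile1// sumr_ge0.
Qed.

Lemma subpmf_convpow u k : subpmf u -> subpmf (convpow u k).
Proof.
move=> u_sub; elim: k => [|k IH]; last exact: subpmf_conv.
apply/subpmfP; split=> [n|[|N]] /=; [by case: ifP|by rewrite big_ord0|].
by rewrite big_ord_recl/= big1 ?addr0.
Qed.

Lemma convpow_at0 u k : u 0%N = 0 -> convpow u k 0 = (k == 0%N)%:R.
Proof. by case: k => [|k] //= u0; rewrite /Defs.conv big_ord1 u0 mulr0. Qed.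

Lemma subpmf_geometric p : 0 <= p <= 1 -> subpmf (fun k => p * (1 - p) ^+ k).
Proof.
move=> /andP[p_ge0 p_le1]; have q_ge0 : 0 <= 1 - p by rewrite subr_ge0.
apply/subpmfP; split=> [k|N]; first by rewrite mulr_ge0// exprn_ge0.
have := subrX1 (1 - p) N; rewrite -mulr_sumr; have := exprn_ge0 N q_ge0; lra.
Qed.

Lemma subpmf_compound_geom p u :
  0 <= p <= 1 -> subpmf u -> subpmf (compound_geom_pmf p u).
Proof.
move=> p01 u_sub; apply: subpmf_mixture (subpmf_geometric p01) _ => k.
exact: subpmf_convpow.
Qed.

Lemma compound_geom_pmf_at0 p u : 0 <= p <= 1 -> u 0%N = 0 ->
  compound_geom_pmf p u 0 = p.
Proof.
move=> p01 u0; have [geom_ge0 _] := subpmf_geometric p01.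
rewrite /compound_geom_pmf (@nneseriesD1 _ _ 0)// => [|k _]; last first.
  by rewrite lee_fin convpow_at0// mulr_ge0.
rewrite eseries0 => [|k _]; first by rewrite adde0 /= expr0 !mulr1.
by move=> /= /negbTE k0; rewrite convpow_at0// k0 mulr0.
Qed.

Lemma le_Hp p u : 0 <= p <= 1 -> (forall k, 0 <= u k) -> p <= Hp p u.
Proof.
move=> /andP[p_ge0 p_le1] u_ge0; rewrite /Hp /=.
have le_t1 : p <= p + (1 - p) * prob_in u [set k | (1 < k)%N].
  by rewrite lerDl mulr_ge0 ?subr_ge0// prob_in_ge0.
by case: ifP => // _; rewrite le_min le_t1/= ler_peMr// lerDl sqrtr_ge0.
Qed.

End CompoundGeometric.

Section WeightedIntegrals.
Context {R : realType} d (T : measurableType d) (mu : {measure set T -> \bar R}).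
Implicit Types f g : T -> R.

Lemma integrable_ge0 f : measurable_fun setT f -> (forall x, 0 <= f x) ->
  (\int[mu]_x (f x)%:E < +oo)%E -> mu.-integrable setT (EFin \o f).
Proof.
move=> f_meas f_ge0 f_fin; apply/integrableP; split; first exact/measurable_EFinP.
by under eq_integral do rewrite /= ger0_norm//.
Qed.

Lemma expR_Rintegral_le f g : (forall x, 0 <= f x) ->
  mu.-integrable setT (EFin \o f) -> \int[mu]_x f x = 1 ->
  mu.-integrable setT (EFin \o (fun x => g x * f x)) ->
  mu.-integrable setT (EFin \o (fun x => expR (g x) * f x)) ->
  expR (\int[mu]_x (g x * f x)) <= \int[mu]_x (expR (g x) * f x).
Proof.
move=> f_ge0 f_int f_mass gf_int expgf_int; set m := Rintegral _ _ _; set e := expR m.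
have tangent_f := integrableZl measurableT (e * (1 - m)) f_int.
have tangent_gf := integrableZl measurableT e gf_int.
have -> : e = \int[mu]_x (e * (1 - m) * f x + e * (g x * f x)).
  by rewrite RintegralD// !RintegralZl// f_mass -/m; ring.
apply: le_Rintegral => //; first exact: (integrableD measurableT tangent_f tangent_gf).
move=> x _; rewrite [leLHS](_ : _ = e * (1 + (g x - m)) * f x); last by ring.
by rewrite ler_wpM2r// -[g x in leRHS](subrKC m) expRD ler_wpM2l ?expR_ge0 ?expR_ge1Dx.
Qed.

End WeightedIntegrals.

Lemma convex_function_tangent_le (R : realType) (D : set (convex_lmodType R^o))
    (g : R -> R) (x y : R) :
  convex_function D (g : _ -> R^o) -> x \in D -> y \in D -> derivable g x 1 ->
  g x + (y - x) * derive1 g x <= g y.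
Proof.
move=> g_convex Dx Dy g'x.
have g_diff : differentiable g x by exact/derivable1_diffP.
have -> : (y - x) * derive1 g x = 'D_(y - x) g x.
  rewrite derive1E !deriveE// -[y - x in RHS]mulr1.
  by rewrite -[(y - x) * 1]/((y - x) *: (1 : R^o)) linearZ.
have g'xy : derivable g x (y - x) by exact: diff_derivable.
rewrite -lerBrDl /derive cvg_at_rightE//; apply: limr_le.
  by apply: cvgP; apply: cvg_dnbhs_at_right; exact: g'xy.
near=> h.
have h_gt0 : 0 < h by near: h; exact: nbhs_right_gt.
have h_le1 : h <= 1 by near: h; exact: nbhs_right_le.
have chord : g (h * y + (1 - h) * x) <= h * g y + (1 - h) * g x :=
  g_convex (Itv01 (ltW h_gt0) h_le1) _ _ Dy Dx.
rewrite /GRing.scale /= mulrC ler_pdivrMr// lerBlDr.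
rewrite (_ : h * (y - x) + x = h * y + (1 - h) * x); last by ring.
by apply: le_trans chord _; lra.
Unshelve. all: by end_near. Qed.

Lemma laplaceE_root_lty (R : realType) (f : R -> R) (lam xi : R) :
  laplace_root f lam xi -> (laplaceE f xi < +oo)%E.
Proof. by move=> [[e e_gt0 near_fin] _]; apply: near_fin; rewrite subrr normr0. Qed.

Lemma expRN_ge_mul (R : realType) (lam s m : R) :
  0 <= (lam - s) * m -> lam * m <= 1 ->
  (lam - s) * m * (2 - lam * m) <= expR (- (s * m)).
Proof.
move=> x_ge0 r_le1.
rewrite (_ : - (s * m) = ((lam - s) * m - 1) + (1 - lam * m)); last by ring.
rewrite expRD ler_pM//; first by lra.
  by apply: le_trans (expR_ge1Dx _); lra.
by apply: le_trans (expR_ge1Dx _); lra.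
Qed.

Lemma series_exp_coeff_le_expR (R : realType) (x : R) n :
  0 <= x -> series (exp_coeff x) n <= expR x.
Proof.
move=> x_ge0; apply: (nondecreasing_cvgn_le _ (is_cvg_series_exp_coeff _)).
by apply: nondecreasing_series => k _ _; exact: exp_coeff_ge0.
Qed.

Section ServiceTime.
Context {R : realType}.
Variable f : R -> R.
Hypotheses (f_meas : measurable_fun setT f) (f_ge0 : forall t, 0 <= f t)
  (f_neg : forall t, t < 0 -> f t = 0)
  (f_mass : (\int[@lebesgue_measure R]_(t in setT) (f t)%:E = 1)%E).
Local Notation mu := (@lebesgue_measure R).
Local Notation m := (fine (ES f)).

Let measurable_expf s : measurable_fun setT (fun x : R => expR (- (s * x)) * f x).
Proof.
apply: measurable_funM => //; apply: measurableT_comp => //.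
by apply: measurableT_comp => //; apply: measurable_funM.
Qed.

Let expf_ge0 s x : 0 <= expR (- (s * x)) * f x.
Proof. by rewrite mulr_ge0 ?expR_ge0. Qed.

Let xf_ge0 x : 0 <= x * f x.
Proof. by have [x_ge0|/f_neg ->] := leP 0 x; rewrite ?mulr0// mulr_ge0. Qed.

Lemma integrable_laplace s : (laplaceE f s < +oo)%E ->
  mu.-integrable setT (EFin \o (fun x => expR (- (s * x)) * f x)).
Proof. by move=> Ls_fin; apply: integrable_ge0 => //; exact: measurable_expf. Qed.

Lemma convex_laplace : convex_function
  ([set s | (laplaceE f s < +oo)%E] : set (convex_lmodType R^o))
  (laplace f : convex_lmodType R^o -> R^o).
Proof.
move=> t x y /set_mem/integrable_laplace int_x /set_mem/integrable_laplace int_y.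
pose p : R := t%:num; pose E s w := expR (- (s * w)) * f w.
have p_ge0 : 0 <= p by rewrite /p.
have q_ge0 : 0 <= 1 - p by rewrite subr_ge0 /p.
have int_px := integrableZl measurableT p int_x.
have int_qy := integrableZl measurableT (1 - p) int_y.
have int_chord := integrableD measurableT int_px int_qy.
have E_convex w : E (p * x + (1 - p) * y) w <= p * E x w + (1 - p) * E y w.
  rewrite /E !mulrA -mulrDl ler_wpM2r//.
  rewrite [- (_ * w)](_ : _ = p * - (x * w) + (1 - p) * - (y * w)); last by ring.
  exact: (convex_expR t (- (x * w)) (- (y * w))).
rewrite -[leRHS]/(p * laplace f x + (1 - p) * laplace f y).
have -> : p * laplace f x + (1 - p) * laplace f y =
    \int[mu]_w (p * E x w + (1 - p) * E y w).
  by rewrite RintegralD// !RintegralZl.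
apply: le_Rintegral => // [|w _]; last exact: E_convex.
apply: le_integrable int_chord => //; first by apply/measurable_EFinP; exact: measurable_expf.
by move=> w _; rewrite /= lee_fin !ger0_norm ?E_convex// addr_ge0// mulr_ge0.
Qed.

Lemma ES_ge0 : (0 <= ES f)%E.
Proof. by apply: integral_ge0 => x _; rewrite lee_fin. Qed.

Let m_ge0 : 0 <= m. Proof. exact/fine_ge0/ES_ge0. Qed.

Lemma expRN_mean_le_laplace s : (ES f < +oo)%E -> (laplaceE f s < +oo)%E ->
  expR (- (s * m)) <= laplace f s.
Proof.
move=> ES_fin Ls_fin.
have int_f : mu.-integrable setT (EFin \o f).
  by apply: integrable_ge0 => //; rewrite f_mass ltry.
have int_xf : mu.-integrable setT (EFin \o (fun x => x * f x)).
  by apply: integrable_ge0 => //; exact: measurable_funM.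
have -> : - (s * m) = \int[mu]_x (- (s * x) * f x).
  under eq_Rintegral do rewrite -mulNr -mulrA.
  by rewrite RintegralZl// mulNr.
apply: expR_Rintegral_le => //; first by rewrite /Rintegral f_mass.
- apply: eq_integrable (integrableZl measurableT (- s) int_xf) => // x _.
  by rewrite /= -EFinM mulrA mulNr.
- exact: integrable_laplace.
Qed.

Lemma laplaceE_le1 s : 0 <= s -> (laplaceE f s <= 1)%E.
Proof.
move=> s_ge0; rewrite -f_mass; apply: ge0_le_integral => //.
- by move=> x _; rewrite lee_fin.
- by apply/measurable_EFinP; exact: measurable_expf.
- exact/measurable_EFinP.
- move=> x _; rewrite lee_fin; have [x0|/f_neg ->] := leP 0 x; last by rewrite mulr0.
  by rewrite ler_piMl// expR_le1 oppr_le0 mulr_ge0.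
Qed.

Lemma laplaceE_lty s : 0 <= s -> (laplaceE f s < +oo)%E.
Proof. by move=> s_ge0; exact: le_lt_trans (laplaceE_le1 s_ge0) (ltry 1). Qed.

Lemma laplace_itv01 s : 0 <= s -> 0 <= laplace f s <= 1.
Proof.
move=> s_ge0; have L_ge0 : (0 <= laplaceE f s)%E.
  by apply: integral_ge0 => x _; rewrite lee_fin.
rewrite fine_ge0//= -[leRHS]/(fine 1) fine_le ?laplaceE_le1//.
by rewrite ge0_fin_numE// laplaceE_lty.
Qed.

Lemma laplace_ge_1B s : (ES f < +oo)%E -> 0 <= s -> 1 - s * m <= laplace f s.
Proof.
move=> ES_fin s_ge0; apply: le_trans (expR_ge1Dx _) _.
by apply: expRN_mean_le_laplace => //; exact: laplaceE_lty.
Qed.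

Lemma laplaceE0 : laplaceE f 0 = 1%E.
Proof.
by rewrite -f_mass; apply: eq_integral => x _; rewrite mul0r oppr0 expR0 mul1r.
Qed.

Lemma laplace_tangent_at0_le1 s : (laplaceE f s < +oo)%E -> derivable (laplace f) s 1 ->
  laplace f s - s * derive1 (laplace f) s <= 1.
Proof.
move=> s_fin ds; rewrite -mulNr -[- s]sub0r.
have <- : laplace f 0 = 1 by rewrite /laplace laplaceE0.
have zero_fin : (laplaceE f 0 < +oo)%E by rewrite laplaceE0 ltry.
exact: (convex_function_tangent_le convex_laplace (mem_set s_fin) (mem_set zero_fin) ds).
Qed.

Lemma subpmf_arrivals lam : 0 <= lam -> subpmf (arrivals_pmf f lam).
Proof.
move=> lam_ge0.
pose arr k x := (f x * expR (- (lam * x)) * (lam * x) ^+ k / k`!%:R)%:E.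
have arr_meas k : measurable_fun setT (arr k).
  apply/measurable_EFinP; apply: measurable_funM => //; apply: measurable_funM.
    by apply: eq_measurable_fun (measurable_expf lam) => x _; rewrite mulrC.
  by apply: measurable_funX; exact: measurable_funM.
have arr_ge0 k x : (0 <= arr k x)%E.
  rewrite lee_fin; have [x0|/f_neg ->] := leP 0 x; last by rewrite !mul0r.
  by rewrite !mulr_ge0 ?expR_ge0 ?exprn_ge0 ?mulr_ge0// invr_ge0.
apply: (@subpmf_fine _ (fun k => \int[mu]_x arr k x)%E) => [k|].
  exact: integral_ge0.
apply: lime_le; first by apply: is_cvg_nneseries => k _ _; exact: integral_ge0.
apply: nearW => N; rewrite -ge0_integral_sum// -f_mass.
apply: ge0_le_integral => //.
- by move=> x _; exact: sume_ge0.
- exact: emeasurable_sum.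
- exact/measurable_EFinP.
move=> x _; rewrite sumEFin lee_fin.
have [x_ge0|/f_neg fx0] := leP 0 x; last by rewrite fx0 big1// => k _; rewrite !mul0r.
under eq_bigr do rewrite -mulrA; rewrite -mulr_sumr -mulrA ler_piMr//.
rewrite -[leRHS](expRxMexpNx_1 (lam * x)) mulrC ler_wpM2r ?expR_ge0//.
by apply: series_exp_coeff_le_expR; rewrite mulr_ge0.
Qed.

Lemma arrivals_pmf0 lam : arrivals_pmf f lam 0 = laplace f lam.
Proof.
congr fine; apply: eq_integral => x _.
by rewrite expr0 fact0 divr1 mulr1 mulrC.
Qed.

Lemma dTV_W_compound_geom_le lam (q : nat -> R) : 0 <= lam -> subpmf q -> q 0%N = 0 ->
  dTV (W_pmf f lam) (compound_geom_pmf (laplace f lam) q) <= 1 - laplace f lam.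
Proof.
move=> lam_ge0 q_sub q0; have p01 := laplace_itv01 lam_ge0.
have W_at0 : W_pmf f lam 0 = laplace f lam by rewrite /W_pmf served_pmf1 arrivals_pmf0.
rewrite -[in leRHS]W_at0; apply: dTV_le_common_atom.
- by apply: subpmf_served; exact: subpmf_arrivals.
- exact: subpmf_compound_geom.
- by rewrite W_at0 compound_geom_pmf_at0.
Qed.

Section StableQueue.
Variable lam : R.
Hypotheses (lam_gt0 : 0 < lam) (stable : (lam%:E * ES f < 1)%E).

Lemma laplace_root_tangent_le xi : laplace_root f lam xi -> xi + lam * laplace f xi <= lam.
Proof.
move=> xi_root; have [_ [der_xi root_xi]] := xi_root.
have := laplace_tangent_at0_le1 (laplaceE_root_lty xi_root) der_xi.
rewrite -(ler_pM2l lam_gt0) mulrBr mulrCA.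
have -> : lam * derive1 (laplace f) xi = -1 by lra.
lra.
Qed.

Lemma stable_ES_lty : (ES f < +oo)%E.
Proof.
by move: stable; rewrite muleC -lte_pdivlMr// mul1e => /lt_trans; apply; exact: ltry.
Qed.

Lemma stable_load_lt1 : lam * m < 1.
Proof.
rewrite -lte_fin EFinM fineK// ge0_fin_numE ?stable_ES_lty//.
exact: ES_ge0.
Qed.

Lemma laplace_root_ratio_itv xi : laplace_root f lam xi ->
  0 <= (xi - lam + lam * laplace f xi) / (xi - lam) <= (1 - lam * m) ^+ 2.
Proof.
move=> root_xi; have tangent := laplace_root_tangent_le root_xi.
have jensen := expRN_mean_le_laplace stable_ES_lty (laplaceE_root_lty root_xi).
have phi_gt0 := lt_le_trans (expR_gt0 _) jensen.
have xi_lt : xi - lam < 0 by have := mulr_gt0 lam_gt0 phi_gt0; lra.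
apply/andP; split; first by rewrite mulr_le0 ?invr_le0 ?(ltW xi_lt)//; lra.
have phi_ge : (lam - xi) * m * (2 - lam * m) <= laplace f xi.
  apply: le_trans jensen; apply: expRN_ge_mul; last exact/ltW/stable_load_lt1.
  by rewrite mulr_ge0//; lra.
rewrite ler_ndivrMr//; have := ler_wpM2l (ltW lam_gt0) phi_ge; lra.
Qed.

End StableQueue.

End ServiceTime.

Lemma mean_excess_ge (R : realType) (p theta rho : R) (m : \bar R) :
  0 < p -> 1 - rho <= p -> 0 <= rho < 1 -> 0 <= p * theta <= (1 - rho) ^+ 2 ->
  ((1 - p * theta)%:E <= ((1 - p) * theta)%:E * m)%E ->
  (((1 - p) / p)%:E <= ((1 - p) / p)%:E * m - (rho / (1 - rho))%:E)%E.
Proof.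
move=> p_gt0 p_ge /andP[rho_ge0 rho_lt1] /andP[x_ge0 x_le].
set x := p * theta in x_ge0 x_le *.
have thetaE : (1 - p) * theta = x * ((1 - p) / p).
  by rewrite /x; field; rewrite gt_eqF.
have [x_gt0|x_le0] := ltP 0 x; last first.
  have x0 : x = 0 by apply/le_anti/andP.
  by rewrite thetaE x0 mul0r mul0e subr0 lee_fin ler10.
rewrite thetaE EFinM -muleA -lee_pdivrMl// -EFinM => odds_le.
rewrite leeBrDr// -EFinD; apply: le_trans odds_le; rewrite lee_fin.
have odds_p : (1 - p) / p <= rho / (1 - rho).
  by rewrite ler_pdivrMr// mulrAC ler_pdivlMr ?subr_gt0//; nra.
have odds_x : 2 * (rho / (1 - rho)) <= x^-1 * (1 - x).
  by rewrite mulrA ler_pdivrMr ?subr_gt0// -mulrA ler_pdivlMl//; nra.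
lra.
Qed.

Theorem theorem3p2 (R : realType) (lam : R) (f : R -> R) (xi : R) (q : nat -> R)
  (hlam : 0 < lam)
  (hf_meas : measurable_fun setT f)
  (hf_ge0 : forall t : R, 0 <= f t)
  (hf_neg : forall t : R, t < 0 -> f t = 0)
  (hf_int : (\int[@lebesgue_measure R]_(t in setT) (f t)%:E = 1)%E)
  (hIFR : IFR f)
  (hrho : (lam%:E * ES f < 1)%E)
  (hxi : nearest_laplace_root f lam xi)
  (hq0 : q 0%N = 0)
  (hq_ge0 : forall k : nat, 0 <= q k)
  (hq_sum : (\sum_(k <oo) (q k)%:E = 1)%E) :
  let p := laplace f lam in
  let theta := (xi - lam + lam * laplace f xi) / ((xi - lam) * laplace f lam) in
  let rho := lam * fine (ES f) in
  (((1 - p) * theta)%:E * mean q >= (1 - p * theta)%:E)%E ->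
  ((dTV (W_pmf f lam) (compound_geom_pmf p q))%:E
     <= (Hp p q)%:E * (((1 - p) / p)%:E * mean q - (rho / (1 - rho))%:E))%E.
Proof.
move=> p theta rho mean_ge; have root_xi := hxi.1.
have rho_ge0 : 0 <= rho by rewrite mulr_ge0 ?(ltW hlam)// fine_ge0// ES_ge0.
have rho_lt1 : rho < 1 by exact: stable_load_lt1.
have p_ge : 1 - rho <= p.
  by apply: laplace_ge_1B => //; [exact: stable_ES_lty hlam hrho | exact: ltW].
have p01 : 0 <= p <= 1 by apply: laplace_itv01 => //; exact: ltW.
have p_gt0 : 0 < p by lra.
have q_sub : subpmf q by split=> //; rewrite hq_sum.
have ptheta : 0 <= p * theta <= (1 - rho) ^+ 2.
  rewrite /theta -/p mulrC invfM mulrA divfK ?gt_eqF//.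
  exact: laplace_root_ratio_itv.
have excess_ge : (((1 - p) / p)%:E <= ((1 - p) / p)%:E * mean q - (rho / (1 - rho))%:E)%E.
  by apply: mean_excess_ge mean_ge => //; rewrite rho_ge0.
apply: (@le_trans _ _ (1 - p)%:E); first by rewrite lee_fin dTV_W_compound_geom_le// ltW.
have -> : (1 - p)%:E = (p%:E * ((1 - p) / p)%:E)%E.
  by rewrite -EFinM mulrC divfK ?gt_eqF.
by rewrite lee_pmul// lee_fin ?divr_ge0 ?le_Hp ?subr_ge0 ?(ltW p_gt0) ?(andP p01).2.
Qed.
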